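(* Along every sequence of integer pairs $(d,n)$ satisfying $d\geq 4$, $n\geq 2d$, and $(\ln n)/d\to\infty$, we have \[ \Delta_u(d,n)\leq n^{1+o(1)}. \]
   Context: A polyhedron is a finite intersection of closed half-spaces; it is pointed if it has at least one vertex. The graph of a pointed polyhedron has its vertices as nodes, two of them being adjacent if they are the endpoints of a (bounded) edge of the polyhedron. The diameter of a pointed polyhedron is the diameter of this graph. $\Delta_u(d,n)$ denotes the maximum diameter of a pointed $d$-dimensional polyhedron (bounded or unbounded) with $n$ facets. *)

(* Defs.v *)
From HB Require Import structures.
From mathcomp Require Import all_boot all_order all_algebra.
From mathcomp Require Import all_classical all_reals all_analysis.

Set Implicit Arguments.
Unset Strict Implicit.
Unset Printing Implicit Defensive.

Import Order.TTheory GRing.Theory Num.Theory.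

Local Open Scope classical_set_scope.
Local Open Scope ring_scope.

Section Polyhedra.
Variables (R : realType) (m : nat).
Implicit Types (a c u v x : 'rV[R]_m) (A F P : set 'rV[R]_m).

Definition dot a x : R := \sum_(i < m) a 0 i * x 0 i.

Definition halfspace (H : set 'rV[R]_m) : Prop :=
  exists (a : 'rV[R]_m) (b : R), a != 0 /\ H = [set x | dot a x <= b].

Definition polyhedron P : Prop :=
  exists (k : nat) (H : 'I_k -> set 'rV[R]_m),
    (forall i, halfspace (H i)) /\ P = \bigcap_i H i.

(* [x0 + U] is the affine hull of [A], i.e. the least affine subspace that
   contains [A]; the empty set has no dimension in this sense. *)
Definition has_dim A (k : nat) : Prop :=
  exists (x0 : 'rV[R]_m) (U : {vspace 'rV[R]_m}),
    [/\ A x0,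
        forall x, A x -> x - x0 \in U,
        forall V : {vspace 'rV[R]_m},
          (forall x, A x -> x - x0 \in V) -> (U <= V)%VS
      & \dim U = k].

(* Taking [c = 0] shows that [P] is a face of itself. *)
Definition face P F : Prop :=
  exists (c : 'rV[R]_m) (b : R),
    (forall x, P x -> dot c x <= b) /\ F = P `&` [set x | dot c x = b].

Definition kface (k : nat) P F : Prop := face P F /\ has_dim F k.

Definition facet P F : Prop := exists k, has_dim P k.+1 /\ kface k P F.

Definition vertex P x : Prop := kface 0 P [set x].

Definition pointed P : Prop := exists x, vertex P x.

Definition segment u v : set 'rV[R]_m :=
  [set (1 - t) *: u + t *: v | t in [set t : R | 0 <= t <= 1]].

(* A one-dimensional face of the form [segment u v] is a bounded edge with
   endpoints [u] and [v]; having dimension 1 forces [u <> v]. *)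
Definition adjacent P u v : Prop :=
  [/\ vertex P u, vertex P v & kface 1 P (segment u v)].

Definition walk P u v (p : seq 'rV[R]_m) : Prop :=
  path (fun x y => `[< adjacent P x y >]) u p /\ last u p = v.

(* The distance between two vertices in different components is [+oo]. *)
Definition distance P u v : \bar R :=
  ereal_inf [set ((size p)%:R)%:E | p in walk P u v].

Definition diameter P : \bar R :=
  ereal_sup [set distance P uv.1 uv.2 | uv in vertex P `*` vertex P].

End Polyhedra.

(* The ambient dimension [m] is arbitrary.  Diameters are natural numbers or
   [+oo], so this supremum is a maximum as soon as it is taken over a nonempty
   set (the empty supremum is [-oo]). *)
Definition Delta_u (R : realType) (d n : nat) : \bar R :=
  ereal_sup [set delta : \bar R |
    exists (m : nat) (P : set 'rV[R]_m),
      [/\ polyhedron P, pointed P, has_dim P d,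
          ([set F | facet P F] #= `I_n)%card
        & delta = diameter P]].

(* Main.v *)
Require Import Defs.
From HB Require Import structures.
From mathcomp Require Import all_boot all_order all_algebra.
From mathcomp Require Import all_classical all_reals all_analysis.
From mathcomp Require Import zify ring lra.

Set Implicit Arguments.
Unset Strict Implicit.
Unset Printing Implicit Defensive.

Import Order.TTheory GRing.Theory Num.Theory.
Import numFieldNormedType.Exports.

(** Since [2 ^ (2 * d) = n `^ (2 * d * ln 2 / ln n)] and the exponent tends to
    [0] when [ln n / d] tends to infinity, it is enough to bound the diameter of
    a pointed [d]-dimensional polyhedron with [n] facets by [n] times a factor
    exponential in [d].  This is Larman's theorem, in the combinatorial form that
    only looks at which inequalities are tight at which vertices; the bound
    obtained is [2 ^ d * (n + 1)] ([diameter_le_facets]).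

    Fix a vertex [u] and put the vertices at distance [i] from [u] in layer [i].
    The main geometric input is that the graph of every face is connected
    ([face_connected]): because a step along an edge raises the layer by at most
    one, the layers that meet a given face form an interval ([walk_level]).  The layers are cut greedily into groups such that some
    inequality is tight at a vertex of every layer of the group.  The vertices
    where it is tight lie in a face of smaller dimension, which bounds the
    length of the group by induction, and the maximality of the groups together
    with the interval property ensures that an inequality is met in at most two
    groups, so each dimension costs a factor of two ([larman]).

    The connectedness of the graph of a face is the simplex method.  The target
    vertex [v] is the unique maximum of the sum of the inequalities that are
    tight at [v], and at any other vertex of the face some edge of the face
    increases this sum ([improving_edge]): among the feasible directions with
    positive objective, one with as many tight inequalities as possible spans an
    extreme ray ([extreme_ray]), and this ray leaves the polyhedron because the
    objective is bounded.

    Finally the inequalities are related to the facets: each inequality of an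
    irredundant system, taken inside the affine hull, is the only tight one at
    some feasible point ([facet_point]).  Hence it defines a facet, and distinct
    inequalities define distinct facets ([irredundant_presentation]). *)

(** * Larman's layer argument *)

(** [X] stands for the vertices, [T x] for the inequalities tight at [x], and
    [rk S] for the dimension of the space of directions along which the
    inequalities in [S] stay tight.  The hypotheses are what survives of
    geometry: a face of rank [0] is a single vertex, a vertex of a larger face
    makes tight some inequality that cuts this face, a direction along which an
    inequality varies in a face is also a direction of the larger faces, and the
    layers meeting a face form an interval. *)
Section Layers.
Import boot.fintype boot.finset.
Variables (X : Type) (J : finType) (T : X -> {set J}) (lev : X -> nat).
Variable rk : {set J} -> nat.

Definition cuts (S : {set J}) (j : J) := (rk (j |: S) < rk S)%N.

Definition occurs (S : {set J}) (a b : nat) (j : J) : Prop :=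
  exists x, [/\ S \subset T x, j \in T x & (a <= lev x <= b)%N].

Definition symbols (S : {set J}) (a b : nat) : {set J} :=
  [set j | cuts S j && `[< occurs S a b j >]].

Hypothesis rk0 : forall (S : {set J}) x y, rk S = 0%N ->
  S \subset T x -> S \subset T y -> lev x = lev y.
Hypothesis rk_gt0 : forall (S : {set J}) x, (0 < rk S)%N -> S \subset T x ->
  exists2 j, j \in T x & cuts S j.
Hypothesis cuts_sub : forall S i j, cuts (i |: S) j -> cuts S j.
Hypothesis lev_interval : forall (S : {set J}) x y i,
  S \subset T x -> S \subset T y ->
  (lev x <= i <= lev y)%N -> exists2 z : X, S \subset T z & lev z = i.

Lemma symbolsP S a b j : reflect (cuts S j /\ occurs S a b j) (j \in symbols S a b).
Proof. by rewrite inE; apply: (iffP andP) => -[? /asboolP]. Qed.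

Lemma symbols_mono S a b a' b' : (a' <= a)%N -> (b <= b')%N ->
  symbols S a b \subset symbols S a' b'.
Proof.
move=> aa bb; apply/subsetP => j /symbolsP[cj [x [Sx jx /andP[ax xb]]]].
apply/symbolsP; split=> //; exists x; split=> //.
by rewrite (leq_trans aa ax) (leq_trans xb bb).
Qed.

(** The symbol [j] is lost because it is constant on the face [j |: S]; this
    strict decrease is what absorbs the [+ 1] of the induction hypothesis in
    [larman]. *)
Lemma symbols_setU1 S a b j : cuts S j -> (exists2 x : X, j |: S \subset T x &
  (a <= lev x <= b)%N) -> (#|symbols (j |: S) a b| < #|symbols S a b|)%N.
Proof.
move=> cj [x jSx lx]; have [jx Sx] : j \in T x /\ S \subset T x.
  by move: jSx; rewrite subUset sub1set => /andP[].
apply: proper_card; apply/properP; split.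
  apply/subsetP => i /symbolsP[/cuts_sub ci [y [jSy iy ly]]].
  apply/symbolsP; split=> //; exists y; split=> //.
  by move: jSy; rewrite subUset => /andP[].
exists j; first by apply/symbolsP; split=> //; exists x.
by apply/negP => /symbolsP[]; rewrite /cuts setUA setUid ltnn.
Qed.

(** Induction on the rank.  In a greedy group [a .. c], where [c] is the last
    layer that shares a symbol [j] with layer [a], the face [j |: S] has smaller
    rank and meets every layer of the group. *)
Lemma larman k (S : {set J}) a b : (rk S <= k)%N -> (a <= b)%N ->
  (forall i, (a <= i <= b)%N -> exists2 x : X, S \subset T x & lev x = i) ->
  (b - a < 2 ^ k * (#|symbols S a b|.+1))%N.
Proof.
have rank0 S' a' b' : rk S' = 0%N -> (a' <= b')%N ->
    (forall i, (a' <= i <= b')%N -> exists2 x : X, S' \subset T x & lev x = i) ->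
    (b' - a' = 0)%N.
  move=> S0 ab lays.
  have [|x Sx lx] := lays a'; first by rewrite leqnn.
  have [|y Sy ly] := lays b'; first by rewrite leqnn andbT.
  by rewrite -lx -ly (rk0 S0 Sx Sy) subnn.
elim: k S a b => [|k IHk] S a b.
  by rewrite leqn0 => /eqP S0 ab /(rank0 _ _ _ S0 ab) ->; rewrite muln_gt0.
move=> rS ab lays; have [S0|rS_gt0] := posnP (rk S).
  by rewrite (rank0 _ _ _ S0 ab lays) muln_gt0 expn_gt0.
(* The right-hand side is a sharpening of twice the number of symbols: symbols
   already present in layer [a] are counted once, for they occur in the first
   group only. *)
suff H : (b - a < 2 ^ k * (#|symbols S a b| +
                       #|symbols S a b :\: symbols S a a|))%N.
  apply: (leq_trans H); rewrite expnSr -mulnA leq_mul2l; apply/orP; right.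
  have := subset_leq_card (subsetDl (symbols S a b) (symbols S a a)); lia.
have [l] := ubnP (b - a).
elim: l a ab lays => [//|l IHl] a ab lays lt_l.
pose run c := (a <= c <= b)%N && (symbols S a a :&: symbols S c c != set0).
have run_a : exists c, run c.
  exists a; rewrite /run leqnn ab setIid /=.
  have [|x Sx lx] := lays a; first by rewrite leqnn.
  have [j jx cj] := rk_gt0 rS_gt0 Sx.
  apply/set0Pn; exists j; apply/symbolsP; split=> //; exists x.
  by rewrite lx leqnn.
have run_b c : run c -> (c <= b)%N by case/andP => /andP[].
have [c /andP[/andP[ac cb] /set0Pn[j jac]] c_max] := ex_maxnP run_a run_b.
move: jac; rewrite in_setI => /andP[].
move=> /symbolsP[cj [x [Sx jx lx]]] /symbolsP[_ [y [Sy jy ly]]].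
have {lx} {}lx : lev x = a by apply/eqP; rewrite eqn_leq andbC.
have {ly} {}ly : lev y = c by apply/eqP; rewrite eqn_leq andbC.
have first_group : (c - a < 2 ^ k * #|symbols S a c|)%N.
  apply: (leq_trans (IHk (j |: S) a c _ ac _)).
  - by rewrite -ltnS; exact: leq_trans cj rS.
  - move=> i; rewrite -{1}lx -{1}ly => aic.
    by apply: lev_interval aic; rewrite subUset sub1set ?jx ?jy.
  rewrite leq_mul2l; apply/orP; right.
  apply: symbols_setU1 => //; exists x; last by rewrite lx leqnn.
  by rewrite subUset sub1set jx.
have [cE|c_lt_b] : c = b \/ (c < b)%N by apply/predU1P; rewrite -leq_eqVlt.
  by rewrite cE in first_group; nia.
(* A symbol of layer [a] that came back after [c] would extend the first
   group. *)
have A'C : [disjoint symbols S a a & symbols S c.+1 b].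
  rewrite -setI_eq0; apply/set0Pn => -[i]; rewrite in_setI.
  case/andP => ia /symbolsP[ci [z [Sz iz /andP[cz zb]]]].
  suff /c_max : run (lev z) by lia.
  rewrite /run (leq_trans _ cz) ?zb /=; last by lia.
  apply/set0Pn; exists i; rewrite in_setI ia; apply/symbolsP; split=> //.
  by exists z; rewrite leqnn.
(* A symbol of the first group that occurs again later is in layer [c.+1], so
   the recursive call counts it once. *)
have AC : symbols S a c :&: symbols S c.+1 b \subset symbols S c.+1 c.+1.
  apply/subsetP => i; rewrite in_setI.
  case/andP => /symbolsP[ci [z [Sz iz lz]]] /symbolsP[_ [t [St it lt]]].
  have [w] : exists2 w : X, i |: S \subset T w & lev w = c.+1.
    by apply: (@lev_interval (i |: S) z t); rewrite ?subUset ?sub1set ?iz ?it //; lia.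
  rewrite subUset sub1set => /andP[iw Sw] lw; apply/symbolsP; split => //.
  by exists w; rewrite lw leqnn.
have rest : (b - c.+1 < 2 ^ k * (#|symbols S c.+1 b| +
    #|symbols S c.+1 b :\: symbols S c.+1 c.+1|))%N.
  apply: IHl => //; last by lia.
  by move=> i /andP[ci ib]; apply: lays; rewrite ib andbT; lia.
have subA : symbols S a c \subset symbols S a b by exact: symbols_mono.
have subC : symbols S c.+1 b \subset symbols S a b by apply: symbols_mono => //; lia.
have le1 : (#|symbols S c.+1 b| <= #|symbols S a b :\: symbols S a a|)%N.
  by apply: subset_leq_card; rewrite subsetD subC disjoint_sym A'C.
have le2 : (#|symbols S a c| + #|symbols S c.+1 b :\: symbols S c.+1 c.+1|
            <= #|symbols S a b|)%N.
  rewrite -cardsUI [X in (_ + #|pred_of_set X|)%N](_ : _ = set0) ?cards0 ?addn0.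
    apply: subset_leq_card; rewrite subUset subA.
    exact: subset_trans (subsetDl _ _) subC.
  by apply/eqP; rewrite setIDA setD_eq0.
by nia.
Qed.
End Layers.

(** * Linear forms, hyperplanes and the ratio test *)

Local Open Scope classical_set_scope.
Local Open Scope ring_scope.

Section Dot.
Variables (R : realType) (m : nat).
Implicit Types a x y : 'rV[R]_m.

Lemma dotD a x y : dot a (x + y) = dot a x + dot a y.
Proof. by rewrite -big_split; apply: eq_bigr => i _; rewrite mxE mulrDr. Qed.

Lemma dotZ a t x : dot a (t *: x) = t * dot a x.
Proof. by rewrite mulr_sumr; apply: eq_bigr => i _; rewrite mxE mulrCA. Qed.

Lemma dotN a x : dot a (- x) = - dot a x.
Proof. by rewrite -scaleN1r dotZ mulN1r. Qed.

Lemma dot0 a : dot a 0 = 0.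
Proof. by rewrite -(scale0r a) dotZ mul0r. Qed.

Lemma dotB a x y : dot a (x - y) = dot a x - dot a y.
Proof. by rewrite dotD dotN. Qed.

Lemma dot_suml (J : finType) (S : {set J}) (a : J -> 'rV[R]_m) x :
  dot (\sum_(j in S) a j) x = \sum_(j in S) dot (a j) x.
Proof.
rewrite /dot exchange_big; apply: eq_bigr => i _ /=.
by rewrite summxE mulr_suml.
Qed.

Fact dot_is_linear a : linear (dot a : 'rV[R]_m -> R^o).
Proof. by move=> t x y; rewrite dotD dotZ. Qed.

HB.instance Definition _ a := GRing.isLinear.Build R 'rV[R]_m R^o _
  (dot a) (dot_is_linear a).

(** The kernel of [dot a] as a subspace, so that directions of faces are vector
    spaces with a dimension. *)
Definition perp a : {vspace 'rV[R]_m} :=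
  lker (linfun (dot a : 'rV[R]_m -> R^o)).

Lemma mem_perp a x : (x \in perp a) = (dot a x == 0).
Proof. by rewrite memv_ker lfunE. Qed.

Lemma dim_cap_perp (V : {vspace 'rV[R]_m}) a z :
  z \in V -> dot a z != 0 -> \dim V = (\dim (V :&: perp a)).+1.
Proof.
move=> zV az.
rewrite -(limg_ker_dim (linfun (dot a : 'rV[R]_m -> R^o)) V) -[RHS]addn1.
congr (_ + _)%N; apply/eqP; rewrite eqn_leq; apply/andP; split.
  by rewrite (leq_trans (dimvS (subvf _))) // dimvf.
rewrite lt0n dimv_eq0; apply/eqP => /eqP.
rewrite -subv0 => /subvP/(_ (dot a z)).
rewrite -[in X in X -> _](lfunE (dot a : 'rV[R]_m -> R^o)) memv_img // => /(_ isT).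
by rewrite memv0 lfunE; apply/negP.
Qed.

End Dot.

Section RatioTest.
Variables (R : realFieldType) (J : finType).

(** Moving from slacks [s] at speeds [g], the first slack to vanish determines
    the longest admissible step [t]; [j1] is the blocking index. *)
Lemma ratio_test (s g : J -> R) : (forall j, 0 <= s j) -> (exists j, 0 < g j) ->
  exists t j1, [/\ 0 <= t, 0 < g j1, t * g j1 = s j1
                 & forall j, t * g j <= s j].
Proof.
move=> s0 [j0 gj0].
case: (arg_minP (fun j => s j / g j) (P := fun j => 0 < g j) gj0) => j1 gj1 jmin.
exists (s j1 / g j1), j1; split => //.
- by rewrite divr_ge0 // ltW.
- by rewrite divfK // gt_eqF.
- move=> j; have [gj|gj] := ltP 0 (g j).
    by rewrite -ler_pdivlMr // jmin.
  by rewrite (le_trans _ (s0 j)) // mulr_ge0_le0 // divr_ge0 // ltW.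
Qed.

End RatioTest.

(** * Faces and vertices of a polyhedron given by inequalities *)

(** A polyhedron is described inside the affine subspace [x0 + U], which makes
    it possible to drop the inequalities that only cut out the affine hull. *)
Section Presentation.
Variables (R : realType) (m : nat) (J : finType).
Variables (x0 : 'rV[R]_m) (U : {vspace 'rV[R]_m}).
Variables (a : J -> 'rV[R]_m) (b : J -> R).
Implicit Types (S : {set J}) (u v w x y z c : 'rV[R]_m).

Definition feasible : set 'rV[R]_m :=
  [set x | x - x0 \in U /\ forall j, dot (a j) x <= b j].

Definition tight x : {set J} := finset (fun j => dot (a j) x == b j).

(** The directions of the face where [S] is tight. *)
Definition lin S : {vspace 'rV[R]_m} := (U :&: \bigcap_(j in S) perp (a j))%VS.

(** The algebraic form of being a vertex; see [vertexE]. *)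
Definition extreme x := feasible x /\ lin (tight x) = 0%VS.

Lemma tightP x j : reflect (dot (a j) x = b j) (j \in tight x).
Proof. by rewrite inE; apply: eqP. Qed.

Lemma linP S z :
  reflect (z \in U /\ forall j, j \in S -> dot (a j) z = 0) (z \in lin S).
Proof.
rewrite memv_cap; apply: (iffP andP) => -[zU zS]; split=> //.
  move=> j jS; apply/eqP; rewrite -mem_perp.
  by move: zS; rewrite memvE => /subv_bigcapP/(_ j jS); rewrite -memvE.
rewrite memvE; apply/subv_bigcapP => j jS.
by rewrite -memvE mem_perp zS.
Qed.

Lemma linS S S' : S \subset S' -> (lin S' <= lin S)%VS.
Proof.
move/fintype.subsetP => SS'; apply/subvP => z /linP[zU zS].
by apply/linP; split=> // j /SS'; exact: zS.
Qed.

Lemma lin_set0 : lin finset.set0 = U.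
Proof.
by apply/vspaceP => z; apply/linP/idP => [[]//|zU]; split=> // j; rewrite inE.
Qed.

Lemma lin_setU1 S j : lin (j |: S) = (lin S :&: perp (a j))%VS.
Proof.
apply/vspaceP => z; rewrite memv_cap mem_perp.
apply/linP/andP => [[zU zS]|[/linP[zU zS] /eqP jz]].
  split; last by rewrite zS // setU11.
  by apply/linP; split=> // i iS; apply: zS; rewrite finset.in_setU iS orbT.
by split=> // i; rewrite finset.in_setU1 => /predU1P[->|/zS].
Qed.

(** Links the rank drop of the layer argument to a direction along which the
    inequality [j] varies. *)
Lemma cutsP S j : reflect (exists2 z, z \in lin S & dot (a j) z != 0)
  (cuts (fun S => \dim (lin S)) S j).
Proof.
rewrite /cuts lin_setU1; apply: (iffP idP) => [|[z zS jz]]; last first.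
  by rewrite (dim_cap_perp zS jz).
apply: contraPP => /forall2NP nz; rewrite (_ : (_ :&: _)%VS = lin S) ?ltnn //.
apply/capv_idPl/subvP => z zS; rewrite mem_perp.
by have [//|/negP] := nz z; rewrite negbK.
Qed.

Lemma feasible_sub x y : feasible x -> feasible y -> x - y \in U.
Proof.
move=> [xU _] [yU _]; have -> : x - y = (x - x0) - (y - x0).
  by rewrite opprB addrA subrK.
by rewrite memvB.
Qed.

Lemma tight_sub S x y : feasible x -> feasible y -> S \subset tight x ->
  S \subset tight y -> x - y \in lin S.
Proof.
move=> Px Py /fintype.subsetP Sx /fintype.subsetP Sy.
apply/linP; split; first exact: feasible_sub.
by move=> j jS; rewrite dotB (tightP _ _ (Sx j jS)) (tightP _ _ (Sy j jS)) subrr.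
Qed.

(** A vertex is determined by its tight set; this is why there are finitely many
    vertices and why they are unique maxima. *)
Lemma extreme_tight_inj u x : extreme u -> feasible x ->
  tight u \subset tight x -> x = u.
Proof.
move=> [Pu Tu] Px ux; apply/eqP; rewrite -subr_eq0 -memv0 -Tu.
exact: tight_sub.
Qed.

(** Some direction of the face is not a direction of the vertex [z], since the
    latter has none. *)
Lemma lin_neq0 S z : extreme z -> S \subset tight z -> lin S != 0%VS ->
  exists2 j, j \in tight z & exists2 y, y \in lin S & dot (a j) y != 0.
Proof.
move=> [_ Tz] Sz S0; have yS := memv_pick (lin S); set y := vpick _ in yS.
have y0 : y != 0 by rewrite vpick0.
apply: contrapT => /forall2NP nz; case/negP: y0.
rewrite -memv0 -Tz; apply/linP; split; first by case/linP: yS.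
move=> j jz; have [//|ny] := nz j; apply/eqP; apply: contrapT => /negP jy.
by apply: ny; exists y.
Qed.

(** The sum of the inequalities in [S] is the linear functional that exposes the
    face where [S] is tight. *)
Lemma dot_sum_le S x : feasible x ->
  dot (\sum_(j in S) a j) x <= \sum_(j in S) b j.
Proof. by move=> [_ Px]; rewrite dot_suml ler_sum. Qed.

Lemma dot_sum_eq S x : feasible x ->
  (dot (\sum_(j in S) a j) x == \sum_(j in S) b j) = (S \subset tight x).
Proof.
move=> [_ Px]; rewrite dot_suml eq_sym -subr_eq0 -sumrB psumr_eq0; last first.
  by move=> j _; rewrite subr_ge0.
apply/allP/fintype.subsetP => [H j jS|H j _].
  apply/tightP/esym/eqP; rewrite -subr_eq0.
  by apply: (implyP (H j _)) => //; rewrite mem_index_enum.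
by apply/implyP => /H/tightP ->; rewrite subrr.
Qed.

Lemma face_tight S : face feasible [set x | feasible x /\ S \subset tight x].
Proof.
exists (\sum_(j in S) a j), (\sum_(j in S) b j); split; first exact: dot_sum_le.
apply/seteqP; split => x /= [Px].
  by rewrite -dot_sum_eq // => /eqP.
by move/eqP; rewrite dot_sum_eq.
Qed.

(** Finitely many inequalities are slack at [x], so a small step does not violate
    them; those tight at [x] do not increase along [z]. *)
Lemma feasible_move x z : feasible x -> z \in U ->
  (forall j, j \in tight x -> dot (a j) z <= 0) ->
  exists2 t, 0 < t & feasible (x + t *: z).
Proof.
move=> [xU Px] zU xz.
have tU t : x + t *: z - x0 \in U.
  by rewrite addrAC memvD // memvZ.
have [/ratio_test rt|/forallNP nz] := pselect (exists j, 0 < dot (a j) z).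
  have [|t [j [t0 jz tj tle]]] := rt (fun j => b j - dot (a j) x).
    by move=> j; rewrite subr_ge0.
  exists t; last first.
    split=> // i; rewrite dotD dotZ -lerBrDl; exact: tle.
  rewrite lt_neqAle t0 andbT; apply/eqP => t00.
  move: tj; rewrite -t00 mul0r => /esym/eqP; rewrite subr_eq0 eq_sym => jx.
  by have := xz j; rewrite inE jx => /(_ isT); rewrite leNgt jz.
exists 1 => //; split=> // j; rewrite scale1r dotD.
by rewrite (le_trans _ (Px j)) // gerDl leNgt; apply/negP.
Qed.

Lemma has_dim_point x : has_dim [set x] 0.
Proof.
exists x, 0%VS; split => //; last by rewrite dimv0.
- by move=> y ->; rewrite subrr mem0v.
- by move=> V _; rewrite sub0v.
Qed.

(** If a direction [z] kept all tight inequalities tight, small steps along [z]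
    and [- z] would stay feasible, hence in every face containing [x]. *)
Lemma vertexE x : vertex feasible x <-> extreme x.
Proof.
split=> [[[c [d [cd Ex]]] _]|Ex].
  have [Px cx] : feasible x /\ dot c x = d.
    by have : [set x] x by []; rewrite Ex => -[].
  split=> //; apply/eqP; rewrite -vpick0; set z := vpick _.
  have : z \in lin (tight x) by exact: memv_pick.
  move=> /linP[zU zx].
  have [|t t0 Pt] := feasible_move Px zU; first by move=> j /zx ->.
  have [||s s0 Ps] := feasible_move (z := - z) Px; first by rewrite memvN.
    by move=> j /zx; rewrite dotN => ->; rewrite oppr0.
  have cz : dot c z = 0.
    have := cd _ Pt; have := cd _ Ps; rewrite !dotD !dotZ dotN cx => *.
    by apply/eqP; rewrite eq_le; apply/andP; split; nra.
  have : [set x] (x + t *: z) by rewrite Ex; split=> //=; rewrite dotD dotZ cz mulr0 addr0.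
  move=> /= /(canRL (addKr _)); rewrite addNr => /eqP.
  by rewrite scaler_eq0 gt_eqF.
split; last exact: has_dim_point.
suff -> : [set x] = [set y | feasible y /\ tight x \subset tight y].
  exact: face_tight.
apply/seteqP; split=> y /=; first by move=> ->; split=> //; case: Ex.
by case=> Py; apply: extreme_tight_inj.
Qed.

(** * Edges, and connectedness of the graph of a face *)

Lemma extreme_slack u x : extreme u -> feasible x -> x != u ->
  exists2 j, j \in tight u & dot (a j) (x - u) < 0.
Proof.
move=> Eu Px; have [/(extreme_tight_inj Eu Px) ->|] := boolP (tight u \subset tight x).
  by rewrite eqxx.
move=> /subsetPn[j ju jx] _; exists j => //.
by rewrite dotB (tightP _ _ ju) subr_lt0 lt_neqAle Px.2 andbT; move: jx; rewrite inE.
Qed.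

Lemma segmentE u w x : segment u w x <-> exists2 t, 0 <= t <= 1 & x - u = t *: (w - u).
Proof.
split=> [[t /= t01 <-]|[t t01 xu]]; exists t => //.
  by rewrite scalerBl scale1r scalerBr addrAC [u - _]addrC addrK addrC.
by rewrite scalerBl scale1r -addrA [X in u + X]addrC -scalerBr -xu addrC subrK.
Qed.

Lemma has_dim_segment u w : u != w -> has_dim (segment u w) 1.
Proof.
move=> uw; exists u, <[w - u]>%VS; split.
- by apply/segmentE; exists 0; rewrite ?lexx ?ler01 // subrr scale0r.
- by move=> x /segmentE[t _ ->]; rewrite memvZ ?memv_line.
- move=> V HV; rewrite -memvE; apply: HV; apply/segmentE.
  by exists 1; rewrite ?ler01 ?lexx // scale1r.
- by rewrite dim_vline subr_eq0 eq_sym uw.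
Qed.

(** The segment is the face where the common tight inequalities of its ends are
    tight: such a point is on the line through [u] and [w], and an inequality tight
    at one end only bounds the parameter on that side. *)
Lemma adjacent_extreme u w : extreme u -> extreme w -> u != w ->
  lin (tight u :&: tight w) = <[w - u]>%VS -> Defs.adjacent feasible u w.
Proof.
move=> Eu Ew uw line; split; [exact/vertexE|exact/vertexE|split]; last first.
  exact: has_dim_segment.
suff -> : segment u w =
    [set x | feasible x /\ tight u :&: tight w \subset tight x].
  exact: face_tight.
have [Pu Pw] := (Eu.1, Ew.1).
apply/seteqP; split=> x /=.
  move=> [t /= /andP[t0 t1] <-]; split; last first.
    apply/fintype.subsetP => j; rewrite finset.in_setI => /andP[/tightP ju /tightP jw].
    by apply/tightP; rewrite dotD !dotZ ju jw -mulrDl subrK mul1r.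
  split; last first.
    move=> j; rewrite dotD !dotZ; have := Pu.2 j; have := Pw.2 j; nra.
  have -> : (1 - t) *: u + t *: w - x0 = (1 - t) *: (u - x0) + t *: (w - x0).
    by rewrite !scalerBr addrACA -opprD -scalerDl subrK scale1r.
  by rewrite memvD // memvZ //; [case: Pu|case: Pw].
move=> [Px Tx]; apply/segmentE.
have /vlineP[t xu] : x - u \in <[w - u]>%VS.
  by rewrite -line; apply: (tight_sub Px Pu) => //; exact: finset.subsetIl.
exists t => //; apply/andP; split.
  have [|j ju jw] := extreme_slack Eu Pw; first by rewrite eq_sym.
  have := Px.2 j; rewrite -(tightP _ _ ju) -subr_le0 -dotB xu dotZ; nra.
have [j jw ju] := extreme_slack Ew Pu uw.
have := Px.2 j; rewrite -(tightP _ _ jw) -subr_le0 -dotB.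
have -> : x - w = (1 - t) *: (u - w).
  apply/(addIr (w - u)); rewrite addrA subrK xu scalerBl scale1r -scalerN opprB.
  by rewrite addrAC -[u - w]opprB addNr add0r.
rewrite dotZ; nra.
Qed.

(** The inequalities tight at [u] cut out the cone of feasible directions, and
    among its members with positive objective one that keeps the most of them
    tight spans an edge of the cone.  If the directions keeping the same
    inequalities tight were more than the line of [y], one of them, independent
    of [y], would have objective [0]; as [u] is a vertex, it or its opposite runs
    into a further inequality, and adding it to [y] up to that point keeps the
    objective unchanged. *)
Lemma extreme_ray u c S y : extreme u -> S \subset tight u ->
  y \in lin S -> (forall j, j \in tight u -> dot (a j) y <= 0) -> 0 < dot c y ->
  exists2 z, z \in lin S /\ 0 < dot c z &
    (forall j, j \in tight u -> dot (a j) z <= 0) /\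
    lin (finset (fun j => (j \in tight u) && (dot (a j) z == 0))) = <[z]>%VS.
Proof.
move=> [Pu Tu] /fintype.subsetP Su.
pose T z := finset (fun j => (j \in tight u) && (dot (a j) z == 0)).
have [n] := ubnP #|~: T y|.
elim: n y => // n IHn y Tn yS yu cy.
have yT : y \in lin (T y).
  by apply/linP; split=> [|j]; [case/linP: yS|rewrite inE => /andP[_ /eqP]].
have [sT|/subvPn[z1 z1T z1y]] := boolP (lin (T y) <= <[y]>)%VS.
  by exists y => //; split=> //; apply/eqP; rewrite eqEsubv sT -memvE.
(* Correct [z1] by a multiple of [y] to make its objective vanish. *)
pose z2 := z1 - (dot c z1 / dot c y) *: y.
have z2T : z2 \in lin (T y) by rewrite memvB // memvZ.
have z2_neq0 : z2 != 0.
  apply: contraNneq z1y => /eqP; rewrite subr_eq0 => /eqP ->.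
  by rewrite memvZ // memv_line.
have cz2 : dot c z2 = 0 by rewrite dotB dotZ divfK ?subrr // gt_eqF.
have [z [zT' cz [j ju jz]]] : exists z, [/\ z \in lin (T y), dot c z = 0 &
    exists2 j, j \in tight u & 0 < dot (a j) z].
  have : z2 \notin lin (tight u) by rewrite Tu memv0.
  have z2U : z2 \in U by case/linP: z2T.
  move=> /linP; rewrite not_andP => -[//|/existsNP[j /not_implyP[ju /eqP jz]]].
  have [jz0|jz0] := ltP 0 (dot (a j) z2).
    by exists z2; split=> //; exists j.
  exists (- z2); split; first by rewrite memvN.
    by rewrite dotN cz2 oppr0.
  by exists j => //; rewrite dotN oppr_gt0 lt_neqAle jz.
(* Only the inequalities tight at [u] matter for the cone at [u]; the others get
   slack and speed [0], hence never block. *)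
pose s j := if j \in tight u then - dot (a j) y else 0.
pose g j := if j \in tight u then dot (a j) z else 0.
have [||t [k [t0 gk tk tle]]] := @ratio_test R J s g.
- by move=> i; rewrite /s; case: ifP => // /yu; rewrite oppr_ge0.
- by exists j; rewrite /g ju.
have ku : k \in tight u by move: gk; rewrite /g; case: ifP => //; rewrite ltxx.
move: gk tk; rewrite /s /g ku => kz tk.
have zT i : i \in tight u -> dot (a i) y = 0 -> dot (a i) z = 0.
  by move=> iu iy; case/linP: zT' => _; apply; rewrite inE iu iy eqxx.
apply: (IHn (y + t *: z)).
- rewrite -ltnS; apply: leq_trans Tn; rewrite ltnS.
  apply: proper_card; apply/properP; split.
    rewrite finset.setCS; apply/fintype.subsetP => i.
    rewrite [_ \in T y]finset.in_set [_ \in T (y + _)]finset.in_set.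
    move=> /andP[iu /eqP iy].
    by rewrite iu dotD dotZ iy zT // mulr0 addr0 eqxx.
  exists k; rewrite finset.in_setC [_ \in T _]finset.in_set ku /=; last first.
    by rewrite dotD dotZ tk subrr eqxx.
  apply: contraTneq kz => /(zT _ ku) ->.
  by rewrite ltxx.
- rewrite memvD // memvZ //; apply/linP; split; first by case/linP: zT'.
  by move=> i iS; apply: zT; [exact: Su|case/linP: yS => _; apply].
- move=> i iu; have := tle i; rewrite /s /g iu dotD dotZ; lra.
- by rewrite dotD dotZ cz mulr0 addr0.
Qed.

(** A simplex step: follow the ray given by [extreme_ray], started from the
    direction [v - u], until an inequality blocks.  It does block because the
    objective is bounded on the polyhedron. *)
Lemma improving_edge u v S c M : extreme u -> feasible v ->
  S \subset tight u -> S \subset tight v -> dot c u < dot c v ->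
  (forall x, feasible x -> dot c x <= M) ->
  exists2 w, extreme w /\ S \subset tight w &
    Defs.adjacent feasible u w /\ dot c u < dot c w.
Proof.
move=> Eu Pv Su Sv cuv cM; have Pu := Eu.1.
have [|||y [yS cy] [yu line]] := @extreme_ray u c S (v - u) Eu Su.
- exact: (tight_sub Pv Pu).
- by move=> j ju; rewrite dotB (tightP _ _ ju) subr_le0 Pv.2.
- by rewrite dotB subr_gt0.
have yU : y \in U by case/linP: yS.
have Puy t : (forall j, t * dot (a j) y <= b j - dot (a j) u) -> feasible (u + t *: y).
  move=> tle; split; first by rewrite addrAC memvD ?memvZ //; case: Pu.
  by move=> j; rewrite dotD dotZ -lerBrDl.
have s0 j : 0 <= b j - dot (a j) u by rewrite subr_ge0 Pu.2.
(* Otherwise the whole ray is feasible, and the step below passes the bound. *)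
have gj : exists j, 0 < dot (a j) y.
  apply: contrapT => /forallNP ny.
  have M0 : 0 <= M - dot c u by rewrite subr_ge0 cM.
  have : feasible (u + ((M - dot c u + 1) / dot c y) *: y).
    apply: Puy => j; rewrite (le_trans _ (s0 j)) // mulr_ge0_le0 //.
      by rewrite divr_ge0 ?(ltW cy) // addr_ge0.
    by rewrite leNgt; apply/negP.
  by move/cM; rewrite dotD dotZ divfK ?gt_eqF //; lra.
have [t [k [t0 ky tk tle]]] := ratio_test s0 gj.
have Pw := Puy t tle; set w := u + t *: y in Pw.
have ku : k \notin tight u by apply/negP => /yu; rewrite leNgt ky.
have t_gt0 : 0 < t.
  rewrite lt_neqAle t0 andbT; apply: contraNneq ku => t00.
  by apply/tightP/esym/eqP; rewrite -subr_eq0 -tk -t00 mul0r.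
have wu : w - u = t *: y by rewrite /w addrAC subrr add0r.
have Tuw : tight u :&: tight w =
    finset (fun j => (j \in tight u) && (dot (a j) y == 0)).
  apply/setP => j; rewrite finset.in_setI [in RHS]finset.in_set.
  have [/tightP ju /=|//] := boolP (j \in tight u).
  rewrite finset.in_set /w dotD dotZ ju -subr_eq0 addrAC subrr add0r mulf_eq0.
  by rewrite (gt_eqF t_gt0).
have lineE : lin (tight u :&: tight w) = <[w - u]>%VS.
  rewrite Tuw line wu; apply/eqP; rewrite eqEsubv -!memvE memvZ ?memv_line // andbT.
  by apply/vlineP; exists t^-1; rewrite scalerA mulVf ?scale1r // gt_eqF.
(* A direction keeping everything tight at [w] is a multiple of [y], and the
   blocking inequality [k] varies along [y]. *)
have Ew : extreme w.
  split=> //; apply/eqP; rewrite -subv0; apply/subvP => z zw.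
  have : z \in lin (tight u :&: tight w).
    by apply: subvP zw; apply: linS; exact: finset.subsetIr.
  rewrite Tuw line => /vlineP[r zr]; case/linP: zw => _ /(_ k).
  rewrite finset.in_set /w dotD dotZ tk addrC subrK eqxx => /(_ isT).
  rewrite zr dotZ => /eqP; rewrite mulf_eq0 (gt_eqF ky) orbF => /eqP ->.
  by rewrite scale0r mem0v.
exists w; split => //.
- apply/fintype.subsetP => j jS; apply/tightP; rewrite /w dotD dotZ.
  have := fintype.subsetP Su j jS => /tightP ->.
  by case/linP: yS => _ /(_ j jS) ->; rewrite mulr0 addr0.
- apply: adjacent_extreme => //; apply: contraTneq t_gt0 => uw.
  have := wu; rewrite -uw subrr => /esym/eqP; rewrite scaler_eq0.
  move=> /predU1P[->|/eqP y0]; first by rewrite ltxx.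
  by move: ky; rewrite y0 dot0 ltxx.
- by rewrite /w dotD dotZ ltrDl mulr_gt0.
Qed.

(** Improving edges towards the objective that exposes [v] lead to [v]: the
    objective increases and there are finitely many vertices above a given value,
    counted through their tight sets. *)
Lemma face_connected S u v : extreme u -> extreme v ->
  S \subset tight u -> S \subset tight v ->
  exists2 p, walk feasible u v p & all (fun x => S \subset tight x) p.
Proof.
move=> Eu Ev Su Sv.
pose c := \sum_(j in tight v) a j; pose M := \sum_(j in tight v) b j.
have cM x : feasible x -> dot c x <= M by exact: dot_sum_le.
have cv : dot c v = M by apply/eqP; rewrite (dot_sum_eq _ Ev.1).
have cx x : feasible x -> dot c x = M -> x = v.
  move=> Px /eqP; rewrite (dot_sum_eq _ Px) => vx.
  exact: extreme_tight_inj Ev Px vx.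
pose above x := finset (fun A : {set J} =>
  `[< exists y, [/\ extreme y, tight y = A & dot c x < dot c y] >]).
have [n] := ubnP #|above u|; elim: n u Eu Su => // n IHn u Eu Su un.
have [->|uv] := eqVneq u v; first by exists [::].
have cuv : dot c u < dot c v.
  rewrite cv lt_neqAle cM ?andbT; last by case: Eu.
  by apply: contraNneq uv => /(cx _ Eu.1) ->.
have [w [Ew Sw] [uw cuw]] := improving_edge Eu Ev.1 Su Sv cuv cM.
have [|p [pw pv] pS] := IHn w Ew Sw.
  rewrite -ltnS; apply: leq_trans un; rewrite ltnS.
  apply: proper_card; apply/properP; split.
    apply/fintype.subsetP => A; rewrite !finset.in_set => /asboolP[y [Ey yA wy]].
    by apply/asboolP; exists y; split=> //; exact: lt_trans wy.
  exists (tight w); rewrite finset.in_set; first by apply/asboolP; exists w.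
  apply/asboolP => -[y [Ey yw]].
  by rewrite (extreme_tight_inj Ew Ey.1) ?ltxx // yw.
exists (w :: p); last by rewrite /= Sw.
by split=> //=; rewrite pw andbT; apply/asboolP.
Qed.

(** * Distance layers and the diameter *)

(** The three properties of the graph distance to [u] that the layer argument
    needs. *)
Lemma distance_level u : extreme u -> exists lev : 'rV[R]_m -> nat,
  [/\ lev u = 0%N,
      forall x y, extreme x -> Defs.adjacent feasible x y ->
        (lev y <= (lev x).+1)%N
    & forall x, extreme x -> exists2 p, walk feasible u x p & size p = lev x].
Proof.
move=> Eu.
pose reach x k := exists2 p, walk feasible u x p & size p = k.
have /choice[lev levP] : forall x, exists k, extreme x ->
    reach x k /\ forall i, reach x i -> (k <= i)%N.
  move=> x; have [Ex|nEx] := pselect (extreme x); last by exists 0%N.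
  have ex_reach : exists k, `[< reach x k >].
    have [||p ux _] := face_connected (S := finset.set0) Eu Ex; rewrite ?finset.sub0set //.
    by exists (size p); apply/asboolP; exists p.
  have [k /asboolP rk kmin] := ex_minnP ex_reach.
  by exists k => _; split=> // i ri; apply: kmin; apply/asboolP.
exists lev; split.
- by apply/eqP; rewrite -leqn0; apply: (levP u Eu).2; exists [::].
- move=> x y Ex xy; have Ey : extreme y by apply/vertexE; case: xy.
  have [[p [pp px] <-] _] := levP x Ex; apply: (levP y Ey).2.
  exists (rcons p y); last by rewrite size_rcons.
  by split; rewrite ?last_rcons // rcons_path pp px; apply/asboolP.
- by move=> x /levP[].
Qed.

(** A discrete intermediate value theorem: no layer can be skipped upwards. *)
Lemma walk_level (lev : 'rV[R]_m -> nat) S x y p i :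
  (forall x y, extreme x -> Defs.adjacent feasible x y -> (lev y <= (lev x).+1)%N) ->
  extreme x -> S \subset tight x -> walk feasible x y p ->
  all (fun z => S \subset tight z) p -> (lev x <= i <= lev y)%N ->
  exists2 z, extreme z & S \subset tight z /\ lev z = i.
Proof.
move=> lev_adj; elim: p x => [|w p IHp] x Ex Sx [] /=.
  by move=> _ <- _ xi; exists x => //; split=> //; lia.
move=> /andP[/asboolP xw pw] wy /andP[Sw Sp] /andP[xi iy].
have [<-|xi_neq] := eqVneq (lev x) i; first by exists x.
apply: (IHp w) => //; first by apply/vertexE; case: xw.
have := lev_adj x w Ex xw; lia.
Qed.

(** All layers up to the distance of [u] and [v] are nonempty, so their number
    is bounded by [larman] applied to the whole polyhedron, the face with no
    tight inequality. *)
Lemma diameter_le : (diameter feasible <= ((2 ^ \dim U * #|J|.+1)%:R)%:E)%E.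
Proof.
apply: ge_ereal_sup => _ [[u v] /= [/vertexE Eu /vertexE Ev] <-].
have [lev [lev0 lev_adj lev_reach]] := distance_level Eu.
have interval S x y i : extreme x -> extreme y -> S \subset tight x ->
    S \subset tight y -> (lev x <= i <= lev y)%N ->
    exists2 z, extreme z & S \subset tight z /\ lev z = i.
  move=> Ex Ey Sx Sy; have [p xy Sp] := face_connected Ex Ey Sx Sy.
  exact: (walk_level (p := p)).
have [p uvp sp] := lev_reach v Ev.
apply: (@le_trans _ _ (size p)%:R%:E).
  by apply: ereal_inf_lbound; exists p.
rewrite lee_fin ler_nat sp.
pose X := {x | extreme x}.
have rk0 S (x y : X) : \dim (lin S) = 0%N -> S \subset tight (sval x) ->
    S \subset tight (sval y) -> lev (sval x) = lev (sval y).
  case: x y => [x [Px _]] [y [Py _]] /= /eqP; rewrite dimv_eq0 => /eqP S0 Sx Sy.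
  congr lev; apply/eqP; rewrite -subr_eq0 -memv0 -S0.
  exact: (tight_sub Px Py).
have rk_gt0 S (x : X) : (0 < \dim (lin S))%N -> S \subset tight (sval x) ->
    exists2 j, j \in tight (sval x) & cuts (fun S => \dim (lin S)) S j.
  case: x => [x Ex] /= S0 Sx.
  have [|j jx jS] := lin_neq0 Ex Sx; first by rewrite -dimv_eq0 -lt0n.
  by exists j => //; apply/cutsP.
have cuts_sub S i j : cuts (fun S => \dim (lin S)) (i |: S) j ->
    cuts (fun S => \dim (lin S)) S j.
  move=> /cutsP[z zS jz]; apply/cutsP; exists z => //.
  by apply: subvP zS; apply: linS; exact: finset.subsetUr.
have lev_interval S (x y : X) i : S \subset tight (sval x) ->
    S \subset tight (sval y) -> (lev (sval x) <= i <= lev (sval y))%N ->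
    exists2 z : X, S \subset tight (sval z) & lev (sval z) = i.
  case: x y => [x Ex] [y Ey] /= Sx Sy xy.
  have [z Ez [Sz lz]] := interval S x y i Ex Ey Sx Sy xy.
  by exists (exist extreme z Ez).
have := @larman X J (fun x : X => tight (sval x)) (fun x : X => lev (sval x))
  (fun S => \dim (lin S)) rk0 rk_gt0 cuts_sub lev_interval (\dim U) finset.set0
  0 (lev v).
rewrite lin_set0 leqnn leq0n subn0 => /(_ isT isT) lt_lev.
apply: (leq_trans (ltnW (lt_lev _))).
  move=> i iv; apply: (lev_interval _ (exist extreme u Eu) (exist extreme v Ev));
  by rewrite ?finset.sub0set //= lev0.
by rewrite leq_mul2l ltnS max_card orbT.
Qed.

End Presentation.

(** * Irredundant inequalities and facets *)

Lemma inj_card_le_finite (J : finType) (T : Type) (f : J -> T) (A : set T) n :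
  injective f -> (forall j, A (f j)) -> (A #= `I_n)%card -> (#|J| <= n)%N.
Proof.
move=> f_inj Af An; have [/card0_eq J0|J_gt0] := posnP #|J|.
  by rewrite eq_card0.
have [j0 _] := card_gt0P J_gt0.
pose g i := f (nth j0 (enum J) i).
rewrite -card_le_II -(card_le_eqr An).
have /card_eqPle[_ gI] : (g @` `I_#|J| #= `I_#|J|)%card.
  apply: inj_card_eq => i k; rewrite !inE /= => iJ kJ /f_inj.
  by move/eqP; rewrite nth_uniq ?enum_uniq -?cardE // => /eqP.
apply: card_le_trans gI _; apply: subset_card_le => _ [i _ <-]; exact: Af.
Qed.

(** The inequalities are irredundant within the affine hull [x0 + U]: dropping
    any of them lets in a new point of that affine subspace. *)
Section Irredundant.
Variables (R : realType) (m : nat) (J : finType).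
Variables (x0 : 'rV[R]_m) (U : {vspace 'rV[R]_m}).
Variables (a : J -> 'rV[R]_m) (b : J -> R).
Implicit Types (S : {set J}) (u v w x y z c : 'rV[R]_m).
Local Notation P := (feasible x0 U a b).
Local Notation tight := (tight a b).
Local Notation lin := (lin U a).

Hypothesis Px0 : P x0.
Hypothesis affine_hull : forall V : {vspace 'rV[R]_m},
  (forall x, P x -> x - x0 \in V) -> (U <= V)%VS.
Hypothesis irredundant : forall j, exists y,
  [/\ y - x0 \in U, forall i, i != j -> dot (a i) y <= b i & b j < dot (a j) y].

(** An inequality tight on all of [P] would be tight on the affine hull, against
    irredundancy; midpoints combine the points where single inequalities are
    strict. *)
Lemma interior_point : exists2 z, P z & forall j, dot (a j) z < b j.
Proof.
have strict j : exists2 x, P x & dot (a j) x < b j.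
  apply: contrapT => /forall2NP nx.
  have ax x : P x -> dot (a j) x = b j.
    move=> Px; apply/eqP; rewrite eq_le Px.2 leNgt; apply/negP.
    by have [] := nx x.
  have [y [yU _]] := irredundant j.
  have /subvP/(_ _ yU) : (U <= perp (a j))%VS.
    by apply: affine_hull => x Px; rewrite mem_perp dotB !ax ?subrr.
  by rewrite mem_perp dotB (ax x0) // subr_eq0 => /eqP ->; rewrite ltxx.
suff [z Pz zs] : exists2 z, P z & forall j, j \in enum J -> dot (a j) z < b j.
  by exists z => // j; apply: zs; rewrite mem_enum.
elim: (enum J) => [|j s [z Pz zs]]; first by exists x0.
have [x Px xj] := strict j.
exists (2^-1 *: x + 2^-1 *: z).
  split; last by move=> i; rewrite dotD !dotZ; have := Px.2 i; have := Pz.2 i; lra.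
  have -> : 2^-1 *: x + 2^-1 *: z - x0 = 2^-1 *: (x - x0) + 2^-1 *: (z - x0).
    rewrite !scalerBr addrACA -opprD -scalerDl (_ : 2^-1 + 2^-1 = 1) ?scale1r //.
    by lra.
  by rewrite memvD // memvZ //; [case: Px|case: Pz].
move=> i; rewrite inE dotD !dotZ => /predU1P[->|/zs iz].
  by have := Pz.2 j; lra.
by have := Px.2 i; lra.
Qed.

(** The segment from an interior point to a point violating [j] alone crosses
    the hyperplane of [j] while the other inequalities are still strict. *)
Lemma facet_point j : exists2 p, P p & tight p = finset.set1 j.
Proof.
have [z Pz zs] := interior_point; have [y [yU yi yj]] := irredundant j.
have := zs j => zj.
have d_gt0 : 0 < dot (a j) y - dot (a j) z by lra.
pose t := (b j - dot (a j) z) / (dot (a j) y - dot (a j) z).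
have t_gt0 : 0 < t by rewrite divr_gt0 // subr_gt0.
have t_lt1 : t < 1 by rewrite ltr_pdivrMr // mul1r ltrD2r.
have tE : t * (dot (a j) y - dot (a j) z) = b j - dot (a j) z.
  by rewrite divfK // gt_eqF.
pose p := z + t *: (y - z).
have pj : dot (a j) p = b j by rewrite dotD dotZ dotB tE addrC subrK.
have pi i : i != j -> dot (a i) p < b i.
  by move=> /yi iy; have := zs i; rewrite dotD dotZ dotB; nra.
have yzU : y - z \in U.
  have -> : y - z = (y - x0) - (z - x0) by rewrite opprB addrA subrK.
  by rewrite memvB //; case: Pz.
exists p.
  split; first by rewrite addrAC memvD ?memvZ //; case: Pz.
  by move=> i; have [->|/pi/ltW//] := eqVneq i j; rewrite pj.
apply/setP => i; rewrite finset.in_set1; apply/tightP/eqP => [ip|-> //].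
by apply: contraPeq ip => /pi; rewrite lt_neqAle => /andP[/eqP].
Qed.

Definition facet_of j : set 'rV[R]_m :=
  [set x | P x /\ finset.set1 j \subset tight x].

Lemma facet_of_inj : injective facet_of.
Proof.
move=> i j ij; have [p Pp pj] := facet_point j.
have : facet_of j p by split=> //; rewrite pj.
by rewrite -ij => -[_]; rewrite pj finset.sub1set finset.in_set1 => /eqP.
Qed.

(** Near the point of [facet_point] the face coincides with the hyperplane of
    [j] in the affine hull, so it spans all directions in that hyperplane. *)
Lemma facet_of_dim j : has_dim (facet_of j) (\dim U).-1.
Proof.
have [p Pp pj] := facet_point j.
have pF : finset.set1 j \subset tight p by rewrite pj.
exists p, (lin (finset.set1 j)); split => //.
- by move=> x [Px xF]; apply: (tight_sub Px Pp).
- move=> V HV; apply/subvP => w /linP[wU wj].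
  have [|t t_gt0 Pt] := feasible_move Pp wU.
    by move=> i; rewrite pj => /wj ->.
  have : p + t *: w - p \in V.
    apply: HV; split=> //; rewrite finset.sub1set; apply/tightP.
    rewrite dotD dotZ wj ?finset.set11 // mulr0 addr0.
    by apply/tightP; rewrite pj finset.set11.
  rewrite addrAC subrr add0r => /(memvZ t^-1).
  by rewrite scalerA mulVf ?scale1r // gt_eqF.
have [y [yU _ yj]] := irredundant j.
have xj := Px0.2 j.
rewrite -(finset.setU0 (finset.set1 j)) lin_setU1 lin_set0.
by rewrite (@dim_cap_perp R m U (a j) (y - x0)) // dotB subr_eq0 gt_eqF //; lra.
Qed.

Lemma card_irredundant n : (0 < \dim U)%N ->
  ([set F | facet P F] #= `I_n)%card -> (#|J| <= n)%N.
Proof.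
move=> dU; apply: (inj_card_le_finite facet_of_inj) => j.
exists (\dim U).-1; split.
  by rewrite prednK //; exists x0, U; split=> // x [].
split; [exact: face_tight|exact: facet_of_dim].
Qed.

End Irredundant.

(** Among the subsets of the given inequalities that suffice inside the affine
    hull of [P], a minimal one is irredundant. *)
Lemma irredundant_presentation (R : realType) (m : nat) (P : set 'rV[R]_m) d n :
  polyhedron P -> has_dim P d.+1 -> ([set F | facet P F] #= `I_n)%card ->
  exists (J : finType) (x0 : 'rV[R]_m) (U : {vspace 'rV[R]_m})
    (a : J -> 'rV[R]_m) (b : J -> R),
    [/\ P = feasible x0 U a b, \dim U = d.+1 & (#|J| <= n)%N].
Proof.
move=> [k [H [Hhalf PE]]] [x0 [U [Px0 PU Umin dU]]] Pn.
have /choice[f fP] : forall i, exists f : 'rV[R]_m * R, H i = [set x | dot f.1 x <= f.2].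
  by move=> i; have [a [b [_ ->]]] := Hhalf i; exists (a, b).
have {}PE x : P x <-> forall i, dot (f i).1 x <= (f i).2.
  rewrite PE; split=> [Px i|Px i _]; last by rewrite fP; exact: Px.
  by have := Px i I; rewrite fP.
pose implies_P (A : {set 'I_k}) := `[< forall x, x - x0 \in U ->
  (forall i, i \in A -> dot (f i).1 x <= (f i).2) -> P x >].
have [|A /minsetP[/asboolP AP Amin]] := @ex_minset _ implies_P.
  by exists [set: 'I_k]%SET; apply/asboolP => x _ xf; apply/PE => i; apply: xf; rewrite inE.
pose J := {i : 'I_k | i \in A}.
pose a (j : J) := (f (val j)).1; pose b (j : J) := (f (val j)).2.
have PF : P = feasible x0 U a b.
  apply/seteqP; split=> x.
    by move=> Px; split; [exact: PU|move=> j; exact: (PE x).1].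
  by move=> [xU xJ]; apply: AP => // i iA; exact: (xJ (exist _ i iA)).
exists J, x0, U, a, b; split => //.
apply: (@card_irredundant R m J x0 U a b); rewrite -?PF ?dU //.
move=> j; apply: contrapT => /forallNP ny.
have : (A :\ val j)%SET = A.
  apply: Amin; last exact: finset.subsetDl.
  apply/asboolP => x xU xA; apply: AP => // i iA.
  have [->|ij] := eqVneq i (val j); last by apply: xA; rewrite !inE ij.
  rewrite leNgt; apply/negP => jx; apply: (ny x); split=> // i' i'j.
  by apply: xA; rewrite !inE (valP i') andbT.
by move/setP/(_ (val j)); rewrite !inE eqxx (valP j).
Qed.

Lemma diameter_le_facets (R : realType) (m : nat) (P : set 'rV[R]_m) d n :
  polyhedron P -> has_dim P d.+1 -> ([set F | facet P F] #= `I_n)%card ->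
  (diameter P <= ((2 ^ d.+1 * n.+1)%:R)%:E)%E.
Proof.
move=> HP Pd Pn; have [J [x0 [U [a [b [-> dU Jn]]]]]] := irredundant_presentation HP Pd Pn.
apply: (le_trans (diameter_le _ _ _ _)).
by rewrite lee_fin ler_nat dU leq_mul2l ltnS Jn orbT.
Qed.

(** * Asymptotics *)

(** The crude factor [2 ^ (2 * d)] absorbs the additive constant. *)
Lemma Delta_u_le (R : realType) d n : (0 < d)%N -> (0 < n)%N ->
  (Delta_u R d n <= ((n * 2 ^ (2 * d))%:R)%:E)%E.
Proof.
case: d => // d _ n_gt0; apply: ge_ereal_sup => _ [m [P [HP _ Pd Pn ->]]].
apply: (le_trans (diameter_le_facets HP Pd Pn)).
rewrite lee_fin ler_nat mul2n -addnn expnD mulnCA leq_mul2l; apply/orP; right.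
by rewrite expnS; have := expn_gt0 2 d; nia.
Qed.

Lemma powR_exponent (R : realType) (n k : nat) : (1 < n)%N ->
  (n%:R `^ (1 + k%:R * ln 2 / ln n%:R) : R) = (n * 2 ^ k)%:R.
Proof.
move=> n_gt1; have n_gt0 : (0 : R) < n%:R by rewrite ltr0n ltnW.
have ln_n : ln (n%:R : R) != 0 by rewrite gt_eqF // ln_gt0 // ltr1n.
rewrite powRD; last by rewrite (gt_eqF n_gt0) implybT.
rewrite powRr1 ?ltW // natrM; congr (_ * _).
by rewrite /powR (gt_eqF n_gt0) divfK // expRM_natl lnK ?natrX // posrE.
Qed.

Theorem corollary16 (R : realType) (d n : nat -> nat)
    (d_ge4 : forall k, (4 <= d k)%N)
    (n_ge2d : forall k, (2 * d k <= n k)%N)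
    (ln_n_over_d : (fun k : nat => ln (n k)%:R / (d k)%:R : R) @ \oo --> +oo) :
  exists eps : nat -> R,
    eps @ \oo --> 0 /\
    forall k, (Delta_u R (d k) (n k) <= ((n k)%:R `^ (1 + eps k))%:E)%E.
Proof.
have d_gt0 k : (0 < d k)%N by have := d_ge4 k; lia.
have n_gt1 k : (1 < n k)%N by have := n_ge2d k; have := d_ge4 k; lia.
exists (fun k => (2 * d k)%:R * ln 2 / ln (n k)%:R); split; last first.
  by move=> k; rewrite powR_exponent // Delta_u_le // ltnW.
have -> : (fun k => (2 * d k)%:R * ln 2 / ln (n k)%:R : R) =
    (fun k => 2 * ln 2 * (ln (n k)%:R / (d k)%:R)^-1).
  by apply/funext => k; rewrite invf_div natrM; ring.
rewrite -[X in _ --> X](mulr0 (2 * ln 2)); apply: cvgMr.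
apply/gtr0_cvgV0 => //; near=> k.
by rewrite divr_gt0 ?ltr0n // ln_gt0 // ltr1n.
Unshelve. all: by end_near.
Qed.
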